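(* Let $(\mathfrak{A}, G, \Theta)$ be a C*-dynamical system with $\mathfrak{A}$ separable and $G$ a countable discrete amenable group, and let $\mathbf{F} = (F_k)_{k=1}^\infty$ be a right Følner sequence for $G$. If $a \in \mathfrak{A}$ is a positive element, then the sequence $\left( \left\| \frac{1}{|F_k|} \sum_{g \in F_k} \Theta_g a \right\| \right)_{k=1}^\infty$ converges to $m\left(a \vert \mathcal{S}^G\right)$.
   Context: A C*-dynamical system $(\mathfrak{A}, G, \Theta)$ (with $G$ discrete) consists of a unital C*-algebra $\mathfrak{A}$ and a left action $\Theta : G \to \operatorname{Aut}(\mathfrak{A})$ by *-automorphisms. $\mathcal{S}^G$ is the set of $\Theta$-invariant states of $\mathfrak{A}$ (states $\phi$ with $\phi \circ \Theta_g = \phi$ for all $g \in G$), with the weak*-topology. For self-adjoint $x$ and compact convex $K \subseteq \mathcal{S}^G$, $m(x \vert K) = \sup_{\psi \in K} \psi(x)$. A right Følner sequence for $G$ is a sequence $(F_k)_{k=1}^\infty$ of nonempty finite subsets of $G$ with $|F_k g \,\Delta\, F_k|/|F_k| \to 0$ for every $g \in G$. *)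

(* Defs.v *)
From HB Require Import structures.
From mathcomp Require Import all_boot all_order all_algebra finmap complex.
From mathcomp Require Import all_classical all_reals all_analysis.

Set Implicit Arguments.
Unset Strict Implicit.
Unset Printing Implicit Defensive.

Import Order.TTheory GRing.Theory Num.Theory numFieldNormedType.Exports.

Local Open Scope classical_set_scope.
Local Open Scope fset_scope.
Local Open Scope complex_scope.
Local Open Scope ring_scope.

(* Unital C*-algebras over the complex numbers R[i], with a real-valued norm.
   mathcomp's norms and algebras only meet in numDomainType, so the norm (and
   its completeness) is spelled out on top of algType rather than inherited from
   completeNormedModType.  As algType excludes the zero ring, 1 != 0. *)
HB.mixin Record isCstarAlgebra (R : realType) A & GRing.Algebra R[i] A := {
  star : A -> A ;
  starK : involutive star ;
  starD : forall x y : A, star (x + y) = star x + star y ;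
  starZ : forall (c : R[i]) (x : A), star (c *: x) = c^* *: star x ;
  starM : forall x y : A, star (x * y) = star y * star x ;
  cnorm : A -> R ;
  cnormD : forall x y : A, cnorm (x + y) <= cnorm x + cnorm y ;
  cnormZ : forall (c : R[i]) (x : A), cnorm (c *: x) = complex.Re `|c| * cnorm x ;
  cnorm0_eq0 : forall x : A, cnorm x = 0 -> x = 0 ;
  cnormM : forall x y : A, cnorm (x * y) <= cnorm x * cnorm y ;
  cnorm_star : forall x : A, cnorm (star x * x) = cnorm x ^+ 2 ;
  cnorm_complete : forall u : nat -> A,
    (forall e : R, 0 < e ->
      exists N, forall m n, (N <= m)%N -> (N <= n)%N -> cnorm (u m - u n) < e) ->
    exists l : A, cnorm (u n - l) @[n --> \oo] --> (0 : R)
}.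

#[short(type="cstarAlgType")]
HB.structure Definition CstarAlgebra (R : realType) :=
  {A of GRing.Algebra R[i] A & isCstarAlgebra R A}.

Section CstarAlgebraNotions.
Context {R : realType} {A : cstarAlgType R}.

Definition self_adjoint (x : A) : Prop := star x = x.

Definition invertible (x : A) : Prop := exists y : A, x * y = 1 /\ y * x = 1.

Definition spectrum (x : A) : set R[i] := [set l | ~ invertible (x - l%:A)].

(* For l : R[i], [0 <= l] means that l is real and nonnegative. *)
Definition positive (x : A) : Prop :=
  self_adjoint x /\ forall l, spectrum x l -> 0 <= l.

Definition state : set {scalar A} :=
  [set phi | (forall x, positive x -> 0 <= phi x) /\ phi 1 = 1].

(* Meant for self-adjoint x, on which states take real values. *)
Definition msup (x : A) (K : set {scalar A}) : R :=
  sup [set complex.Re (psi x) | psi in K].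

Definition star_automorphism (f : {lrmorphism A -> A}) : Prop :=
  {morph f : x / star x} /\ bijective f.

End CstarAlgebraNotions.

Definition separable (R : realType) (A : cstarAlgType R) : Prop :=
  exists2 D : set A, countable D &
    forall (x : A) (e : R), 0 < e -> exists2 y, D y & cnorm (x - y) < e.

Record cstar_action (R : realType) (G : groupType) (A : cstarAlgType R) := {
  act :> G -> {lrmorphism A -> A} ;
  act_aut : forall g, star_automorphism (act g) ;
  act1 : forall x, act 1%g x = x ;
  actM : forall g h x, act (g * h)%g x = act g (act h x)
}.

Definition invariant_states (R : realType) (G : groupType)
    (A : cstarAlgType R) (Theta : cstar_action G A) : set {scalar A} :=
  [set phi | state phi /\ forall g x, phi (Theta g x) = phi x].

(* A left-invariant mean on the bounded real functions on G; the values of m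
   at unbounded functions are irrelevant. *)
Definition left_invariant_mean (R : realType) (G : groupType)
    (m : (G -> R) -> R) : Prop :=
  [/\ forall (c : R) (f h : G -> R), bounded_fun f -> bounded_fun h ->
        m (fun x => c * f x + h x) = c * m f + m h,
      forall f : G -> R, bounded_fun f -> (forall x, 0 <= f x) -> 0 <= m f,
      m (fun=> 1) = 1 &
      forall (g : G) (f : G -> R), bounded_fun f ->
        m (fun x => f (g * x)%g) = m f].

Definition amenable (R : realType) (G : groupType) : Prop :=
  exists m : (G -> R) -> R, left_invariant_mean m.

Definition right_translate (G : groupType) (F : {fset G}) (g : G) : {fset G} :=
  [fset (h * g)%g | h in F].

Definition fsymdiff (T : choiceType) (X Y : {fset T}) : {fset T} :=
  (X `\` Y) `|` (Y `\` X).

Definition right_Folner (R : realType) (G : groupType) (F : nat -> {fset G})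
    : Prop :=
  (forall k, F k != fset0) /\
  forall g : G,
    (#|` fsymdiff (right_translate (F k) g) (F k)|%:R / #|` F k|%:R : R)
      @[k --> \oo] --> (0 : R).

Definition ergodic_average (R : realType) (G : groupType)
    (A : cstarAlgType R) (Theta : cstar_action G A) (F : {fset G}) (a : A) : A :=
  (#|` F|%:R)^-1 *: \sum_(g <- F) Theta g a.

(* Main.v *)
Require Import Defs.
From HB Require Import structures.
From mathcomp Require Import all_boot all_order all_algebra finmap complex.
From mathcomp Require Import all_classical all_reals all_analysis.
From mathcomp Require Import ring lra.
Import Order.TTheory GRing.Theory Num.Theory numFieldNormedType.Exports.
Local Open Scope classical_set_scope.
Local Open Scope ring_scope.
Set Implicit Arguments.
Unset Strict Implicit.
Unset Printing Implicit Defensive.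

(** Write A_k x for the average of the Theta_g x over F_k, and m for the supremum
    of the values at a of the invariant states.

    An invariant state takes the same value at a and at A_k a, and a state does
    not exceed the norm at a self-adjoint element, so m <= |A_k a| for every k.

    For the converse no state is attached to each single A_k a; one application
    of the Hahn-Banach theorem deals with the whole sequence.  For self-adjoint x
    let p x be the upper limit of the largest spectral value of A_k x.  Since the
    largest spectral value of y is |t + y| - t for large t, p is described by
    norms alone ([asym_bound], [asym_max]) and extends to a sublinear functional
    on the whole algebra.  A real linear f <= p with f a = p a then gives a
    complex functional phi ([asymptotic_state]).  It is positive, because A_k
    preserves positivity; normalized, because A_k 1 = 1; and invariant, because
    the right Folner condition makes A_k (Theta_h x - x) tend to 0 in norm
    ([ergodic_average_translate]).  As a is positive, |A_k a| is the largest
    spectral value of A_k a, so phi a = p a is the upper limit of the |A_k a|, and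
    this upper limit is at most m.

    What makes norms and positivity interchangeable is that |x| or -|x| is a
    spectral value of each self-adjoint x ([norm_spectrum]).  This is proved
    without the spectral radius formula.  Let |S| = 1 and suppose that 1 - S^2 had
    an inverse c.  Then G_k = 1 + S^2 + ... + S^(2(2^k - 1)) = (1 - S^(2^(k+1))) c
    would be bounded by 2|c|.  But G_k is the product of the 1 + S^(2^(i+1)) for
    i < k, and the inequality |r (1 + T^2)| >= 2 |r T| for commuting self-adjoint
    r and T, used for T = S^(2^i), gives |G_k| >= 2^k |S^(2^k - 1)| >= 2^k. *)

(** * Norm and involution *)

Section NormStar.
Context {R : realType} {A : cstarAlgType R}.
Implicit Types (x y z : A) (t : R) (c : R[i]).
Local Open Scope complex_scope.

Lemma cnormR t x : cnorm (t%:C *: x) = `|t| * cnorm x.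
Proof. by rewrite cnormZ normc_def /= expr0n addr0 sqrtr_sqr. Qed.

Lemma cnormI x : cnorm ('i *: x) = cnorm x.
Proof. by rewrite cnormZ normc_def /= expr0n add0r expr1n sqrtr1 mul1r. Qed.

Lemma cnormN x : cnorm (- x) = cnorm x.
Proof. by rewrite -scaleN1r -(rmorphN1 (real_complex R)) cnormR normrN1 mul1r. Qed.

Lemma cnorm_0 : cnorm (0 : A) = 0.
Proof. by rewrite -(scale0r (0 : A)) -(rmorph0 (real_complex R)) cnormR normr0 mul0r. Qed.

Lemma cnormB x y : cnorm (x - y) <= cnorm x + cnorm y.
Proof. by rewrite -(cnormN y) cnormD. Qed.

Lemma cnorm_ge0 x : 0 <= cnorm x.
Proof. by have := cnormB x x; rewrite subrr cnorm_0 -mulr2n pmulrn_lge0. Qed.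

Lemma cnorm_gt0 x : x != 0 -> 0 < cnorm x.
Proof.
by move=> x0; rewrite lt_def cnorm_ge0 andbT; apply: contraNneq x0 => /cnorm0_eq0 ->.
Qed.

Lemma cnorm_lerB x y : cnorm x - cnorm y <= cnorm (x + y).
Proof. by rewrite lerBlDr -{1}(addrK y x) cnormB. Qed.

Lemma conj_real t : ((t%:C)^* = t%:C)%R.
Proof. exact: conjc_real. Qed.

Lemma conj_i : (('i%C : R[i])^* = - 'i%C)%R.
Proof. by rewrite -[LHS]/(conjc 'i%C); simpc. Qed.

Lemma starR t x : star (t%:C *: x) = t%:C *: star x.
Proof. by rewrite starZ conj_real. Qed.

Lemma starN x : star (- x) = - star x.
Proof. by rewrite -scaleN1r -(rmorphN1 (real_complex R)) starR rmorphN1 scaleN1r. Qed.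

Lemma star0 : star (0 : A) = 0.
Proof. by rewrite -(scale0r (0 : A)) -(rmorph0 (real_complex R)) starR rmorph0 !scale0r. Qed.

Lemma starB x y : star (x - y) = star x - star y.
Proof. by rewrite starD starN. Qed.

Lemma star1 : star (1 : A) = 1.
Proof. by rewrite -[LHS]mulr1 -{2}(starK 1) -starM mulr1 starK. Qed.

Lemma starX x n : star (x ^+ n) = star x ^+ n.
Proof. by elim: n => [|n IH]; rewrite ?star1// exprSr starM IH exprS. Qed.

Lemma cnorm_starE x : cnorm (star x) = cnorm x.
Proof.
suff le y : cnorm y <= cnorm (star y).
  by apply/le_anti; rewrite le andbT -{2}(starK x) le.
have [->|y0] := eqVneq y 0; first by rewrite star0.
have := cnormM (star y) y.
by rewrite cnorm_star expr2 ler_pM2r// cnorm_gt0.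
Qed.

Lemma cnorm1 : cnorm (1 : A) = 1.
Proof.
have := cnorm_star (1 : A); rewrite star1 mulr1 expr2 => e.
have n0 : cnorm (1 : A) != 0 by rewrite gt_eqF// cnorm_gt0 ?oner_neq0.
by apply: (mulfI n0); rewrite mulr1.
Qed.

Lemma cnorm_scalar t : cnorm (t%:C%:A : A) = `|t|.
Proof. by rewrite cnormR cnorm1 mulr1. Qed.

Lemma cnormX_le x n : cnorm (x ^+ n) <= cnorm x ^+ n.
Proof.
elim: n => [|n IH]; first by rewrite !expr0 cnorm1.
by rewrite !exprS (le_trans (cnormM _ _))// ler_wpM2l ?cnorm_ge0.
Qed.

Lemma cnorm_sum (I : Type) (s : seq I) (f : I -> A) :
  cnorm (\sum_(i <- s) f i) <= \sum_(i <- s) cnorm (f i).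
Proof.
elim: s => [|i s IH]; first by rewrite !big_nil cnorm_0.
by rewrite !big_cons (le_trans (cnormD _ _))// lerD2l.
Qed.

Lemma self_adjoint1 : self_adjoint (1 : A). Proof. exact: star1. Qed.

Lemma self_adjointD x y : self_adjoint x -> self_adjoint y -> self_adjoint (x + y).
Proof. by rewrite /self_adjoint starD => -> ->. Qed.

Lemma self_adjointB x y : self_adjoint x -> self_adjoint y -> self_adjoint (x - y).
Proof. by rewrite /self_adjoint starB => -> ->. Qed.

Lemma self_adjointR t x : self_adjoint x -> self_adjoint (t%:C *: x).
Proof. by rewrite /self_adjoint starR => ->. Qed.

Lemma self_adjointX x n : self_adjoint x -> self_adjoint (x ^+ n).
Proof. by rewrite /self_adjoint starX => ->. Qed.

Lemma self_adjoint_scalar t : self_adjoint (t%:C%:A : A).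
Proof. exact/self_adjointR/self_adjoint1. Qed.

Lemma cnorm_sqr x : self_adjoint x -> cnorm (x ^+ 2) = cnorm x ^+ 2.
Proof. by move=> sx; rewrite expr2 -{1}sx cnorm_star. Qed.

Lemma cnorm_exp2n x k : self_adjoint x -> cnorm (x ^+ (2 ^ k)) = cnorm x ^+ (2 ^ k).
Proof.
move=> sx; elim: k => [|k IH]; first by rewrite !expr1.
by rewrite expnSr !exprM cnorm_sqr ?IH//; exact: self_adjointX.
Qed.

End NormStar.

(** * Spectrum *)

Section Spectrum.
Context {R : realType} {A : cstarAlgType R}.
Implicit Types (x y z : A) (t : R) (c l : R[i]).
Local Open Scope complex_scope.

Lemma invertibleZ c x : c != 0 -> invertible x -> invertible (c *: x).
Proof.
move=> c0 [y [xy yx]]; exists (c^-1 *: y).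
by rewrite -!scalerAl -!scalerAr !scalerA xy yx divff// mulVf// scale1r.
Qed.

Lemma invertibleN x : invertible (- x) -> invertible x.
Proof. by case=> y [xy yx]; exists (- y); rewrite mulrN mulNr -{1}mulNr xy -mulrN yx. Qed.

(** The inverse is the sum of the Neumann series. *)
Lemma invertible_1B x : cnorm x < 1 -> invertible (1 - x).
Proof.
set q := cnorm x => q1; have q0 : 0 <= q by exact: cnorm_ge0.
have q1' : 0 < 1 - q by rewrite subr_gt0.
pose u n := \sum_(i < n) x ^+ i.
have uM n : (1 - x) * u n = 1 - x ^+ n.
  by rewrite /u -[1 - x]opprB mulNr -subrX1 opprB.
have uMr n : u n * (1 - x) = 1 - x ^+ n.
  rewrite -uM mulr_sumr mulr_suml; apply: eq_bigr => i _.
  by rewrite mulrBl mulrBr mul1r mulr1 -exprS -exprSr.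
have cvq : q ^+ n @[n --> \oo] --> (0 : R).
  by apply: cvg_expr; rewrite ger0_norm.
have small e : 0 < e -> \forall n \near \oo, q ^+ n < e.
  move=> e0; have /cvgrPdist_lt/(_ e e0) := cvq.
  by apply: filterS => n; rewrite sub0r normrN ger0_norm// exprn_ge0.
have le_uB n m : (n <= m)%N -> cnorm (u m - u n) <= (1 - q)^-1 * q ^+ n.
  move=> nm; rewrite ler_pdivlMl ?subr_gt0//.
  have -> : u m - u n = \sum_(n <= i < m) x ^+ i.
    by rewrite /u -!(big_mkord xpredT (fun i => x ^+ i)) (big_cat_nat (leq0n n) nm)/=
      [LHS]addrC [LHS]addKr.
  apply: (@le_trans _ _ ((1 - q) * \sum_(n <= i < m) q ^+ i)).
    apply: ler_wpM2l; first by rewrite subr_ge0 ltW.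
    rewrite (le_trans (cnorm_sum _ _))//; apply: ler_sum => i _; exact: cnormX_le.
  have -> : (1 - q) * \sum_(n <= i < m) q ^+ i = q ^+ n - q ^+ m.
    rewrite mulr_sumr (eq_bigr (fun i => - (q ^+ i.+1 - q ^+ i))).
      by rewrite sumrN telescope_sumr// opprB.
    by move=> i _; rewrite exprS; ring.
  by rewrite gerBl exprn_ge0.
have [|l ul] := @cnorm_complete R A u.
  move=> e e0; have [N _ HN] := small _ (mulr_gt0 q1' e0).
  have le m n : (N <= n)%N -> (n <= m)%N -> cnorm (u m - u n) < e.
    move=> Nn nm; apply: le_lt_trans (le_uB _ _ nm) _.
    by rewrite ltr_pdivrMl//; apply: HN.
  exists N => m n Nm Nn; have [nm|/ltnW mn] := leqP n m; first exact: le.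
  by rewrite -cnormN opprB; exact: le.
(* The error terms of both products tend to 0 along the partial sums. *)
have lim0 (v : A) (C : R) :
  (forall n, cnorm v <= C * cnorm (u n - l) + q ^+ n) -> v = 0.
  move=> vC; apply: cnorm0_eq0; apply/le_anti; rewrite cnorm_ge0 andbT.
  have h : C * cnorm (u n - l) + q ^+ n @[n --> \oo] --> (0 : R).
    rewrite -[X in _ --> X](addr0 0) -[X in _ --> X + _](mulr0 C).
    by apply: cvgD => //; apply: cvgM => //; exact: cvg_cst.
  rewrite -(cvg_lim _ h)//; apply: limr_ge; first by apply/cvg_ex; exists 0.
  by apply: nearW.
exists l; split; apply/subr0_eq; apply: (lim0 _ (cnorm (1 - x))) => n.
  have -> : (1 - x) * l - 1 = - ((1 - x) * (u n - l)) - x ^+ n.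
    by rewrite mulrBr uM !opprB [x ^+ n - 1]addrC addrA addrK.
  rewrite (le_trans (cnormB _ _))// cnormN lerD ?cnormX_le//; exact: cnormM.
have -> : l * (1 - x) - 1 = - ((u n - l) * (1 - x)) - x ^+ n.
  by rewrite mulrBl uMr !opprB [x ^+ n - 1]addrC addrA addrK.
by rewrite (le_trans (cnormB _ _))// cnormN lerD ?cnormX_le// mulrC cnormM.
Qed.

Lemma spectrum_le_norm x l : spectrum x l -> complex.Re `|l| <= cnorm x.
Proof.
move=> xl; rewrite leNgt; apply/negP => lt; apply: xl; apply: invertibleN.
have l0 : l != 0.
  apply: contraTneq lt => ->; rewrite normr0 /= -leNgt; exact: cnorm_ge0.
have -> : - (x - l%:A) = l *: (1 - l^-1 *: x).
  by rewrite scalerBr scalerA divff// scale1r opprB.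
apply: invertibleZ => //; apply: invertible_1B.
rewrite -(ltr_pM2l (_ : 0 < complex.Re `|l|)); last exact: le_lt_trans (cnorm_ge0 x) lt.
by rewrite -cnormZ scalerA divff// scale1r mulr1.
Qed.

Lemma spectrumD x c l : spectrum x l -> spectrum (x + c%:A) (l + c).
Proof. by rewrite /spectrum /= scalerDl opprD addrACA subrr addr0. Qed.

(** The imaginary part b of a spectral value of x would satisfy
    (b + t)^2 <= |x + it|^2 = |x^2 + t^2| <= |x|^2 + t^2 for every real t. *)
Lemma self_adjoint_spectrum x l : self_adjoint x -> spectrum x l -> complex.Im l = 0.
Proof.
move=> sx xl; set b := complex.Im l; apply/eqP/negPn/negP => b0.
have main t : (b + t) ^+ 2 <= cnorm x ^+ 2 + t ^+ 2.
  pose c : R[i] := 'i * t%:C.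
  have cc : c * c = - (t ^+ 2)%:C.
    by rewrite /c mulrACA -expr2 sqr_i mulN1r -expr2 rmorphXn.
  pose y := x + c%:A.
  have ly : complex.Re `|l + c| <= cnorm y.
    by apply: spectrum_le_norm; exact: spectrumD.
  have sy : star y = x - c%:A.
    by rewrite /y starD sx starZ star1 /c rmorphM/= conj_real conj_i mulNr scaleNr.
  have yy : star y * y = x ^+ 2 + (t ^+ 2)%:C%:A.
    rewrite sy /y mulrDr !mulrBl -!scalerAl -!scalerAr !mul1r !mulr1 scalerA cc scaleNr.
    by rewrite opprK expr2 addrA addrNK.
  have le2 : cnorm y ^+ 2 <= cnorm x ^+ 2 + t ^+ 2.
    rewrite -cnorm_star yy (le_trans (cnormD _ _))// cnorm_sqr// cnorm_scalar.
    by rewrite ger0_norm ?sqr_ge0.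
  apply: le_trans le2.
  have : complex.Re `|l + c| ^+ 2 <= cnorm y ^+ 2.
    by rewrite lerXn2r// ?nnegrE ?cnorm_ge0// normc_def /= sqrtr_ge0.
  apply: le_trans; rewrite normc_def /= sqr_sqrtr; last by rewrite addr_ge0 ?sqr_ge0.
  by rewrite /b; case: (l) => l1 l2 /=; nra.
(* With this t, the linear term 2bt alone exceeds |x|^2. *)
have := main ((cnorm x ^+ 2 + 1) / (2 * b)).
have -> : forall s, (b + s) ^+ 2 = b ^+ 2 + 2 * b * s + s ^+ 2 by move=> s; ring.
rewrite lerD2r mulrC divfK; last by rewrite mulf_neq0// pnatr_eq0.
by have := sqr_ge0 b; lra.
Qed.

End Spectrum.

(** * Norm and spectrum of self-adjoint elements *)

Section SpectralNorm.
Context {R : realType} {A : cstarAlgType R}.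
Implicit Types (x y z r S : A) (t s : R) (l : R[i]).
Local Open Scope complex_scope.

Lemma self_adjointM x y :
  self_adjoint x -> self_adjoint y -> GRing.comm x y -> self_adjoint (x * y).
Proof. by rewrite /self_adjoint starM => -> -> ->. Qed.

Lemma cnorm_double x : cnorm (x *+ 2) = 2 * cnorm x.
Proof.
by rewrite -scaler_nat -(rmorph_nat (real_complex R)) cnormR normr_nat.
Qed.

(** The left-hand side is the norm of the self-adjoint part of the normal element
    w = y + iz, and the right-hand side is |w^* w| = |w|^2. *)
Lemma cnorm_sqrD_ge y z : self_adjoint y -> self_adjoint z -> GRing.comm y z ->
  cnorm y ^+ 2 <= cnorm (y ^+ 2 + z ^+ 2).
Proof.
move=> sy sz yz; pose w := y + 'i *: z.
have sw : star w = y - 'i *: z by rewrite starD sy starZ sz conj_i scaleNr.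
have -> : y ^+ 2 + z ^+ 2 = star w * w.
  rewrite sw /w mulrDr !mulrBl -!scalerAl -!scalerAr yz scalerA -(expr2 'i) sqr_i.
  by rewrite scaleN1r opprK -!expr2 addrA addrNK.
rewrite cnorm_star lerXn2r ?nnegrE ?cnorm_ge0//.
have : cnorm (y *+ 2) <= cnorm w + cnorm (star w).
  by apply: le_trans (cnormD _ _); rewrite sw /w addrACA subrr addr0.
by rewrite cnorm_starE cnorm_double mulr_natl mulr2n -mulr2n -[leRHS]mulr2n ler_pMn2r.
Qed.

(** By [cnorm_sqrD_ge], since
    (r (1 + x^2))^2 = (2 r x)^2 + (r (x^2 - 1))^2. *)
Lemma cnorm_1D_sqr_ge r x : self_adjoint r -> self_adjoint x -> GRing.comm r x ->
  2 * cnorm (r * x) <= cnorm (r * (1 + x ^+ 2)).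
Proof.
move=> sr sx rx.
have rx2 : GRing.comm r (x ^+ 2) by exact: commrX.
have rxB : GRing.comm r (x ^+ 2 - 1).
  by rewrite /GRing.comm mulrBr mulrBl rx2 mulr1 mul1r.
have rxD : GRing.comm r (1 + x ^+ 2).
  by rewrite /GRing.comm mulrDr mulrDl rx2 mulr1 mul1r.
have srx : self_adjoint (r * x) by exact: self_adjointM.
have srB : self_adjoint (r * (x ^+ 2 - 1)).
  apply: self_adjointM => //; apply: self_adjointB (self_adjoint1); exact: self_adjointX.
have srD : self_adjoint (r * (1 + x ^+ 2)).
  apply: self_adjointM => //; apply: (self_adjointD self_adjoint1); exact: self_adjointX.
have E : (r * x *+ 2) ^+ 2 + (r * (x ^+ 2 - 1)) ^+ 2 = (r * (1 + x ^+ 2)) ^+ 2.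
  rewrite exprMn_n (exprMn_comm _ rx) (exprMn_comm _ rxB) (exprMn_comm _ rxD).
  rewrite -mulrnAr -mulrDr; congr (_ * _).
  rewrite [1 + _]addrC sqrrB1 sqrrD1 -[(2 ^ 2)%N]/(2 + 2)%N mulrnDr.
  by rewrite [LHS]addrA addrACA subrr addr0 [X in X + 1]addrC.
rewrite -cnorm_double -(@ler_pXn2r _ 2) ?nnegrE ?cnorm_ge0//.
rewrite -(cnorm_sqr srD) -E; apply: cnorm_sqrD_ge => //.
  by rewrite /self_adjoint mulr2n starD srx.
apply: commr_sym; apply: commrMn; apply: commr_sym.
suff xB : GRing.comm x (x ^+ 2 - 1).
  apply: commr_sym; apply: commrM.
    apply: commr_sym; apply: commrM => //.
  by apply: commr_sym; apply: commrM => //; exact: commr_sym.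
by rewrite /GRing.comm mulrBr mulrBl -exprS -exprSr mulr1 mul1r.
Qed.

(** The geometric sum of the first 2^k powers of S^2, in factored form. *)
Definition dyadic_prod (S : A) k : A := \prod_(i < k) (1 + S ^+ (2 ^ i.+1)).

Lemma dyadic_prodM S k : dyadic_prod S k * (1 - S ^+ 2) = 1 - S ^+ (2 ^ k.+1).
Proof.
rewrite /dyadic_prod; elim: k => [|k IH]; first by rewrite big_ord0 mul1r.
rewrite big_ord_recr /= -mulrA.
have -> : (1 + S ^+ (2 ^ k.+1)) * (1 - S ^+ 2) = (1 - S ^+ 2) * (1 + S ^+ (2 ^ k.+1)).
  rewrite mulrDl mul1r [RHS]mulrDr [in RHS]mulr1; congr (_ + _).
  by rewrite mulrBr mulrBl mulr1 mul1r -!exprD addnC.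
rewrite mulrA IH [in RHS]expnSr exprM mulrDr mulr1 mulrBl mul1r -expr2.
by rewrite addrA addrNK.
Qed.

Lemma dyadic_prod_comm S k n : GRing.comm (dyadic_prod S k) (S ^+ n).
Proof.
apply: commr_sym; apply: commr_prod => i _.
by rewrite /GRing.comm mulrDr mulrDl mulr1 mul1r -!exprD addnC.
Qed.

Lemma self_adjoint_dyadic_prod S k : self_adjoint S -> self_adjoint (dyadic_prod S k).
Proof.
move=> sS; rewrite /dyadic_prod; elim: k => [|k IH].
  by rewrite big_ord0; exact: self_adjoint1.
rewrite big_ord_recr /=; apply: self_adjointM => //.
  apply: (self_adjointD self_adjoint1); exact: self_adjointX.
rewrite /GRing.comm mulrDr mulrDl mulr1 mul1r.
by congr (_ + _); exact: dyadic_prod_comm.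
Qed.

(** Each factor 1 + T^2 counts for at least 2T, and the product of the
    T = S^(2^i) for i < k is S^(2^k - 1).  The power S^n makes the induction
    work: it absorbs the T of the factors already treated. *)
Lemma cnorm_dyadic_prod_ge S k n : self_adjoint S ->
  2 ^+ k * cnorm (S ^+ (n + (2 ^ k).-1)) <= cnorm (S ^+ n * dyadic_prod S k).
Proof.
move=> sS; elim: k n => [|k IH] n.
  by rewrite expr0 mul1r expn0 addn0 /dyadic_prod big_ord0 mulr1.
rewrite /dyadic_prod big_ord_recr /= -/(dyadic_prod S k) mulrA expnSr exprM.
apply: le_trans (@cnorm_1D_sqr_ge _ _ _ _ _); last 3 first.
- apply: self_adjointM; [exact: self_adjointX|exact: self_adjoint_dyadic_prod|].
  by apply: commr_sym; exact: dyadic_prod_comm.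
- exact: self_adjointX.
- apply: commr_sym; apply: commrM; first by rewrite /GRing.comm -!exprD addnC.
  by apply: commr_sym; exact: dyadic_prod_comm.
rewrite -mulrA dyadic_prod_comm mulrA -exprD exprS -mulrA ler_pM2l//.
apply: le_trans (IH _); rewrite ler_pM2l ?exprn_gt0//.
by rewrite muln2 -addnn -addnA -!subn1 -addnBA ?expn_gt0.
Qed.

(** An inverse c would bound the geometric sums of S^2 by 2|c|, while by
    [cnorm_dyadic_prod_ge] they grow at least like 2^k. *)
Lemma unit_norm_not_invertible (S : A) :
  self_adjoint S -> cnorm S = 1 -> ~ invertible (1 - S ^+ 2).
Proof.
move=> sS S1 [c [bc _]].
have normX n : cnorm (S ^+ n) <= 1 by rewrite (le_trans (cnormX_le _ _))// S1 expr1n.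
have bound k : 2 ^+ k <= 2 * cnorm c.
  apply: (@le_trans _ _ (cnorm (dyadic_prod S k))).
    have := @cnorm_dyadic_prod_ge S k 0 sS; rewrite expr0 mul1r add0n.
    apply: le_trans; rewrite ler_peMr ?exprn_ge0//.
    have := cnormM S (S ^+ (2 ^ k).-1).
    by rewrite -exprS prednK ?expn_gt0// S1 mul1r cnorm_exp2n// S1 expr1n.
  have -> : dyadic_prod S k = (1 - S ^+ (2 ^ k.+1)) * c.
    by rewrite -dyadic_prodM -mulrA bc mulr1.
  rewrite (le_trans (cnormM _ _))// ler_wpM2r ?cnorm_ge0//.
  by rewrite (le_trans (cnormB _ _))// cnorm1 lerD2l.
pose k := (Num.truncn (2 * cnorm c)).+1.
have := le_lt_trans (bound k) (truncnS_gt _); rewrite -/k -natrX ltr_nat.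
by rewrite ltnNge ltnW// ltn_expl.
Qed.

(** After scaling to norm 1, this is [unit_norm_not_invertible] for the product
    (1 - S) (1 + S) = 1 - S^2. *)
Lemma norm_spectrum x : self_adjoint x ->
  spectrum x (cnorm x)%:C \/ spectrum x (- cnorm x)%:C.
Proof.
move=> sx; apply: contrapT => /not_orP[/contrapT inv1 /contrapT inv2].
have [x0|x0] := eqVneq x 0.
  move: inv1; rewrite x0 cnorm_0 rmorph0 scale0r subr0 => -[y [/eqP]].
  by rewrite mul0r eq_sym oner_eq0.
set n := cnorm x in inv1 inv2; have n0 : 0 < n by exact: cnorm_gt0.
have nC0 : n%:C != 0 :> R[i] by rewrite (fmorph_eq0 (real_complex R)) gt_eqF.
pose S := (n^-1)%:C *: x.
have S1 : cnorm S = 1 by rewrite cnormR gtr0_norm ?invr_gt0// mulVf ?gt_eqF.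
apply: (unit_norm_not_invertible (self_adjointR n^-1 sx) S1).
have nS : n%:C *: S = x.
  by rewrite scalerA -rmorphM divff ?gt_eqF// rmorph1 scale1r.
have invZ y : invertible (n%:C *: y) -> invertible y.
  move=> /(@invertibleZ _ _ n%:C^-1 _ _); rewrite invr_eq0 scalerA mulVf// scale1r.
  exact.
have [u [xu ux]] : invertible (1 - S).
  by apply: invertibleN; apply: invZ; rewrite opprB scalerBr nS.
have [v [xv vx]] : invertible (1 + S).
  by apply: invZ; rewrite scalerDr nS addrC -[n%:C]opprK -rmorphN scaleNr.
have -> : 1 - S ^+ 2 = (1 - S) * (1 + S).
  by rewrite mulrDr mulr1 mulrBl mul1r addrA addrNK.
exists (v * u); split; rewrite mulrA -[X in X * _]mulrA.
  by rewrite xv mulr1.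
by rewrite ux mulr1.
Qed.

End SpectralNorm.

(** * Positive elements and states *)

Section Positive.
Context {R : realType} {A : cstarAlgType R}.
Implicit Types (x y z r : A) (t s : R) (l : R[i]).
Local Open Scope complex_scope.

Lemma spectrum_reflect x t l : spectrum (t%:C%:A - x) l -> spectrum x (t%:C - l).
Proof.
move=> h inv; apply: h; apply: invertibleN.
suff -> : - (t%:C%:A - x - l%:A) = x - (t%:C - l)%:A by [].
by rewrite scalerBl !opprB addrCA.
Qed.

(** The norm of y = t - x is up to sign a spectral value of y, so t - |y| or
    t + |y| is one of x.  Together with [positive_of_dist] this describes
    positivity by norms alone, from which positive elements are seen to form a
    cone. *)
Lemma positive_dist x t : positive x -> cnorm x <= t -> cnorm (t%:C%:A - x) <= t.
Proof.
move=> [sx px] xt; set y := _ - x.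
have sy : self_adjoint y by apply: self_adjointB => //; exact: self_adjoint_scalar.
have [] := norm_spectrum sy => /spectrum_reflect h.
  by have := px _ h; rewrite -rmorphB ler0c subr_ge0.
have := spectrum_le_norm h; rewrite -rmorphB opprK normc_def /= expr0n addr0 sqrtr_sqr.
have t0 := le_trans (cnorm_ge0 x) xt; have y0 := cnorm_ge0 y.
by rewrite ger0_norm ?addr_ge0//; lra.
Qed.

Lemma positive_of_dist x t : self_adjoint x -> cnorm (t%:C%:A - x) <= t -> positive x.
Proof.
move=> sx xt; split=> // l xl.
have l0 := self_adjoint_spectrum sx xl.
have : spectrum (t%:C%:A - x) (t%:C - l).
  by apply: spectrum_reflect; rewrite opprB addrC addrNK.
move/spectrum_le_norm; rewrite lecE /= l0 eqxx /=.
case: l l0 {xl} => l1 l2 /= ->; rewrite !(oppr0, addr0) expr0n addr0 sqrtr_sqr.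
by move=> /le_trans/(_ xt); rewrite ler_norml; lra.
Qed.

Lemma positiveD x y : positive x -> positive y -> positive (x + y).
Proof.
move=> px py; have [[sx _] [sy _]] := (px, py).
apply: (@positive_of_dist _ (cnorm x + cnorm y)); first exact: self_adjointD.
rewrite rmorphD scalerDl opprD addrACA (le_trans (cnormD _ _))// lerD// positive_dist//.
Qed.

Lemma positiveR t x : 0 <= t -> positive x -> positive (t%:C *: x).
Proof.
move=> t0 px; have [sx _] := px.
apply: (@positive_of_dist _ (t * cnorm x)); first exact: self_adjointR.
rewrite rmorphM -scalerA -scalerBr cnormR ger0_norm// ler_wpM2l//.
exact: positive_dist.
Qed.

Lemma positive0 : positive (0 : A).
Proof.
by apply: (@positive_of_dist _ 0); rewrite ?subr0 ?cnorm_scalar ?normr0//; exact: star0.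
Qed.

(** Positivity decides the alternative of [norm_spectrum]: |x| itself is a
    spectral value of x, so t + |x| is one of t + x. *)
Lemma cnorm_addr_positive t x : 0 <= t -> positive x -> cnorm (t%:C%:A + x) = t + cnorm x.
Proof.
move=> t0 [sx px]; apply/le_anti/andP; split.
  by rewrite (le_trans (cnormD _ _))// cnorm_scalar ger0_norm.
have xn : spectrum x (cnorm x)%:C.
  have [//|h] := norm_spectrum sx; suff -> : cnorm x = - cnorm x by [].
  by have := px _ h; rewrite ler0c; have := cnorm_ge0 x; lra.
have : spectrum (x + t%:C%:A) ((cnorm x)%:C + t%:C) by exact: spectrumD.
move/spectrum_le_norm; rewrite -rmorphD normc_def /= expr0n addr0 sqrtr_sqr.
by rewrite ger0_norm ?addr_ge0 ?cnorm_ge0// addrC [_ + x]addrC.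
Qed.

(** The element |x| - x is positive. *)
Lemma state_le_cnorm (phi : {scalar A}) x :
  state phi -> self_adjoint x -> complex.Re (phi x) <= cnorm x.
Proof.
move=> [pos phi1] sx.
have : positive ((cnorm x)%:C%:A - x).
  apply: (@positive_of_dist _ (cnorm x)).
    by apply: self_adjointB => //; exact: self_adjoint_scalar.
  by rewrite opprB addrC subrK.
move/pos; rewrite linearB linearZ /= phi1 mulr1.
by case: (phi x) => p1 p2; rewrite lecE /= subr_ge0 => /andP[].
Qed.

End Positive.

(** * The Hahn-Banach theorem *)

Section HahnBanach.
Context {R : realType} {V : lmodType R}.
Implicit Types (p q : V -> R) (x y : V) (t : R).

Definition sublinear p : Prop :=
  (forall x y, p (x + y) <= p x + p y) /\
  (forall t x, 0 < t -> p (t *: x) <= t * p x).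

Lemma sublinearZ p t x : sublinear p -> 0 < t -> p (t *: x) = t * p x.
Proof.
move=> [_ pZ] t0; apply/le_anti; rewrite pZ//=.
rewrite -ler_pdivlMl//; apply: le_trans (pZ _ _ _); last by rewrite invr_gt0.
by rewrite scalerK ?gt_eqF.
Qed.

Lemma sublinear0 p : sublinear p -> p 0 = 0.
Proof. by move=> /sublinearZ/(_ (ltr0n R 2)) => /(_ 0); rewrite scaler0; lra. Qed.

Lemma sublinearN p x : sublinear p -> - p (- x) <= p x.
Proof.
by move=> sp; have [pD _] := sp; have := pD x (- x); rewrite subrr sublinear0//; lra.
Qed.

Lemma inf_le_mem (S : set R) c u : (forall u, S u -> c <= u) -> S u -> inf S <= u.
Proof. by move=> h Su; apply: ge_inf => //; exists c. Qed.

(** For sublinear p, the largest sublinear r <= p such that r (- y) <= - p y. *)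
Definition linearize p y x : R := inf [set p (x + t *: y) - t * p y | t in [set t | 0 <= t]].

(** Shows that the infimum in [linearize] is over a set bounded below. *)
Lemma linearize_lbound p y x t : sublinear p -> 0 <= t ->
  - p (- x) <= p (x + t *: y) - t * p y.
Proof.
move=> sp; rewrite le_eqVlt => /predU1P[<-|t0].
  by rewrite scale0r mul0r addr0 subr0; exact: sublinearN.
have [pD _] := sp; have := pD (x + t *: y) (- x).
by rewrite addrAC subrr add0r sublinearZ//; lra.
Qed.

Lemma linearize_le p y x t : sublinear p -> 0 <= t ->
  linearize p y x <= p (x + t *: y) - t * p y.
Proof.
move=> sp t0; apply: (@inf_le_mem _ (- p (- x))); last by exists t.
by move=> _ [s s0 <-]; exact: linearize_lbound.
Qed.

Lemma linearize_glb p y x c :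
  (forall t, 0 <= t -> c <= p (x + t *: y) - t * p y) -> c <= linearize p y x.
Proof.
move=> h; apply: lb_le_inf => [|_ [t t0 <-]]; last exact: h.
by exists (p (x + 0 *: y) - 0 * p y); exists 0 => //; exact: lexx.
Qed.

Lemma linearize_sublinear p y : sublinear p -> sublinear (linearize p y).
Proof.
move=> sp; have [pD _] := sp; split=> [x1 x2|t x t0].
  rewrite -lerBlDr; apply: linearize_glb => t1 h1.
  rewrite lerBlDl -lerBlDr; apply: linearize_glb => t2 h2.
  rewrite lerBlDr; apply: le_trans (linearize_le _ _ sp (addr_ge0 h1 h2)) _.
  have := pD (x1 + t1 *: y) (x2 + t2 *: y).
  by rewrite addrACA -scalerDl mulrDl; lra.
rewrite -ler_pdivrMl//; apply: linearize_glb => s s0.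
rewrite ler_pdivrMl//; have := linearize_le y (t *: x) sp (mulr_ge0 (ltW t0) s0).
by rewrite -scalerA -scalerDr (sublinearZ _ sp t0) -mulrA -mulrBr.
Qed.

Lemma linearize_le_self p y x : sublinear p -> linearize p y x <= p x.
Proof.
by move=> sp; have := linearize_le y x sp (lexx 0); rewrite scale0r mul0r subr0 addr0.
Qed.

(** Zorn's lemma: the pointwise infimum of a chain is sublinear, and it is finite
    because q x >= - p (- x) for every sublinear q below p. *)
Lemma minimal_sublinear p : sublinear p -> exists q, [/\ sublinear q, (forall x, q x <= p x) &
  forall r, sublinear r -> (forall x, r x <= q x) -> r = q].
Proof.
move=> sp; pose T := {q : V -> R | sublinear q /\ forall x, q x <= p x}.
pose rel (u v : T) : bool := `[< forall x, sval v x <= sval u x >].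
have [|u v w /asboolP uv /asboolP vw|u v /asboolP uv /asboolP vu|B Btot|] := @Zorn T rel.
- by move=> u; apply/asboolP.
- by apply/asboolP => x; exact: le_trans (vw x) (uv x).
- apply: eq_sig_hprop => [q ? ?|]; first exact: Prop_irrelevance.
  by apply/funext => x; apply/le_anti; rewrite uv vu.
- have [B0|/set0P[u0 Bu0]] := eqVneq B set0.
    by exists (exist _ p (conj sp (fun=> lexx _))) => s; rewrite B0.
  pose m x := inf [set sval u x | u in B].
  have lb x (u : T) : - p (- x) <= sval u x.
    case: u => q [sq qp] /=; apply: le_trans (sublinearN x sq).
    by rewrite lerN2.
  have m_le x (u : T) : B u -> m x <= sval u x.
    move=> Bu; apply: (@inf_le_mem _ (- p (- x))); last by exists u.
    by move=> _ [v _ <-].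
  have m_glb x c : (forall u : T, B u -> c <= sval u x) -> c <= m x.
    move=> h; apply: lb_le_inf => [|_ [u Bu <-]]; last exact: h.
    by exists (sval u0 x); exists u0.
  have sm : sublinear m.
    split=> [x y|t x t0].
      rewrite -lerBlDr; apply: (m_glb) => u Bu; rewrite lerBlDl -lerBlDr.
      apply: (m_glb) => v Bv; rewrite lerBlDr.
      have [/asboolP uv|/asboolP vu] := Btot _ _ Bu Bv.
        apply: le_trans (m_le _ _ Bv) _; apply: le_trans ((svalP v).1.1 _ _) _.
        by rewrite addrC lerD2l.
      apply: le_trans (m_le _ _ Bu) _; apply: le_trans ((svalP u).1.1 _ _) _.
      by rewrite addrC lerD2r.
    rewrite -ler_pdivrMl//; apply: (m_glb) => u Bu; rewrite ler_pdivrMl//.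
    by apply: le_trans (m_le _ _ Bu) _; exact: (svalP u).1.2.
  have mp x : m x <= p x by apply: le_trans (m_le _ _ Bu0) _; exact: (svalP u0).2.
  by exists (exist _ m (conj sm mp)) => u Bu; apply/asboolP => x; exact: m_le.
move=> [q [sq qp]] qmin; exists q; split=> // r sr rq.
have rp x : r x <= p x by exact: le_trans (rq x) (qp x).
have /(congr1 sval) : exist _ r (conj sr rp) = exist _ q (conj sq qp) :> T.
  by apply: qmin; apply/asboolP.
exact.
Qed.

(** A minimal sublinear functional q equals its own linearizations, whence
    q x + q y <= q (x + y) and q is linear.  Taking it below the linearization
    of p along a forces the value at a, as that one is at most - p a at - a. *)
Lemma hahn_banach p a : sublinear p ->
  exists f : V -> R, [/\ scalar f, forall x, f x <= p x & f a = p a].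
Proof.
move=> sp; have [f [sf fle fmin]] := minimal_sublinear (linearize_sublinear a sp).
have fD x y : f (x + y) = f x + f y.
  apply/le_anti; rewrite sf.1/=.
  have fy : linearize f y = f.
    by apply: fmin => [|z]; [exact: linearize_sublinear|exact: linearize_le_self].
  by have := linearize_le y x sf ler01; rewrite fy scale1r mul1r; lra.
have fN x : f (- x) = - f x.
  by have := fD x (- x); rewrite subrr sublinear0//; lra.
have fp x : f x <= p x by apply: le_trans (fle x) _; exact: linearize_le_self.
exists f; split=> //.
  move=> t x y; rewrite fD; congr (_ + _).
  have [t0|t0|->] := ltgtP t 0.
  - by rewrite -[t *: x]opprK -scaleNr fN sublinearZ ?oppr_gt0// mulNr opprK.
  - exact: sublinearZ.
  - by rewrite scale0r mul0r sublinear0.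
apply/le_anti; rewrite fp/=.
have := le_trans (fle (- a)) (linearize_le a (- a) sp ler01).
by rewrite scale1r mul1r addNr sublinear0// fN; lra.
Qed.

End HahnBanach.

(** * Complex functionals from real sublinear ones *)

Section Complexification.
Context {R : realType}.
Local Open Scope complex_scope.

(** A complex vector space regarded as a real one. *)
Definition realification (V : lmodType R[i]) : Type := V.

Section RealScaling.
Context (V : lmodType R[i]).
Implicit Types (x y : V) (t s : R).

HB.instance Definition _ := GRing.Zmodule.copy (realification V) V.

Let rscale t (x : realification V) : realification V := t%:C *: (x : V).

Let rscaleA t s x : rscale t (rscale s x) = rscale (t * s) x.
Proof. by rewrite /rscale scalerA -rmorphM. Qed.

Let rscale1 : left_id 1 rscale.
Proof. by move=> x; rewrite /rscale rmorph1 scale1r. Qed.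

Let rscaleDr : right_distributive rscale +%R.
Proof. by move=> t x y; rewrite /rscale scalerDr. Qed.

Let rscaleDl x : {morph rscale^~ x : t s / t + s}.
Proof. by move=> t s; rewrite /rscale rmorphD scalerDl. Qed.

HB.instance Definition _ := GRing.Zmodule_isLmodule.Build R (realification V)
  rscaleA rscale1 rscaleDr rscaleDl.

End RealScaling.

Lemma hahn_banach_complex (V : lmodType R[i]) (p : V -> R) (a : V) :
  (forall x y, p (x + y) <= p x + p y) ->
  (forall t x, 0 < t -> p (t%:C *: x) <= t * p x) ->
  exists f : V -> R, [/\ forall t x y, f (t%:C *: x + y) = t * f x + f y,
    forall x, f x <= p x & f a = p a].
Proof. by move=> pD pZ; exact: (@hahn_banach R (realification V) p a (conj pD pZ)). Qed.

(** The only complex linear functional with real part g. *)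
Definition complexify (V : lmodType R[i]) (g : V -> R) (x : V) : R[i] :=
  g x -i* g ('i *: x).

Lemma complexify_scalar (V : lmodType R[i]) (g : V -> R) :
  (forall t x y, g (t%:C *: x + y) = t * g x + g y) -> scalar (complexify g).
Proof.
move=> gl [b c] x y; rewrite /complexify.
have gD u v : g (u + v) = g u + g v.
  by have := gl 1 u v; rewrite rmorph1 scale1r mul1r.
have g0 : g 0 = 0 by have := gD 0 0; rewrite addr0; lra.
have gZ t u : g (t%:C *: u) = t * g u by have := gl t u 0; rewrite !addr0 g0 addr0.
have -> : (b +i* c) *: x = b%:C *: x + c%:C *: ('i *: x).
  by rewrite scalerA -scalerDl; congr (_ *: _); simpc.
have i_mul : 'i *: (b%:C *: x + c%:C *: ('i *: x)) = b%:C *: ('i *: x) + (- c)%:C *: x.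
  by rewrite scalerDr !scalerA; congr (_ *: _ + _ *: _); simpc.
rewrite scalerDr i_mul !gD !gZ.
by apply/eqP; rewrite eq_complex /=; apply/andP; split; apply/eqP; ring.
Qed.

End Complexification.

(** * States from sequences of positive unital maps *)

Section AsymptoticState.
Context {R : realType} {A : cstarAlgType R}.
Implicit Types (x y : A) (t r e : R).
Local Open Scope complex_scope.

Context (L : nat -> {linear A -> A}).
Context (L_1 : forall k, L k 1 = 1).
Context (L_cnorm : forall k x, cnorm (L k x) <= cnorm x).
Context (L_star : forall k x, L k (star x) = star (L k x)).
Context (L_positive : forall k x, positive x -> positive (L k x)).

(** Adding a large t moves the whole spectrum of L_k x to the positive side,
    where the norm measures the largest spectral value. *)
Definition asym_bound x r : Prop :=
  exists2 t : R, 0 <= t & \forall k \near \oo, cnorm (t%:C%:A + L k x) <= t + r.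

(** For self-adjoint x, the upper limit of the largest spectral value of L_k x. *)
Definition asym_max x : R := inf [set r | asym_bound x r].

Lemma asym_boundD x y r1 r2 :
  asym_bound x r1 -> asym_bound y r2 -> asym_bound (x + y) (r1 + r2).
Proof.
move=> [t t0 ht] [s s0 hs]; exists (t + s); first exact: addr_ge0.
near=> k; rewrite linearD rmorphD scalerDl addrACA [leRHS]addrACA.
by rewrite (le_trans (cnormD _ _))// lerD//; near: k.
Unshelve. all: by end_near. Qed.

Lemma asym_boundZ x r s : 0 < s -> asym_bound x r -> asym_bound (s%:C *: x) (s * r).
Proof.
move=> s0 [t t0 ht]; exists (s * t); first by rewrite mulr_ge0// ltW.
near=> k; rewrite linearZ /= rmorphM -scalerA -scalerDr cnormR gtr0_norm// -mulrDr.
by rewrite ler_pM2l//; near: k.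
Unshelve. all: by end_near. Qed.

Lemma asym_bound_ge x r : asym_bound x r -> - cnorm x <= r.
Proof.
move=> [t t0 [N _ /(_ N (leqnn _)) /= h]].
have := le_trans (cnorm_lerB _ _) h; rewrite cnorm_scalar ger0_norm//.
by have := L_cnorm N x; lra.
Qed.

Lemma asym_bound_cnorm x : asym_bound x (cnorm x).
Proof. by exists 0 => //; apply: nearW => k; rewrite scale0r !add0r. Qed.

Lemma asym_max_le x r : asym_bound x r -> asym_max x <= r.
Proof. by apply: inf_le_mem => u; exact: asym_bound_ge. Qed.

Lemma asym_max_glb x r : (forall u, asym_bound x u -> r <= u) -> r <= asym_max x.
Proof. by move=> h; apply: lb_le_inf => //; exists (cnorm x); exact: asym_bound_cnorm. Qed.

Lemma asym_maxD x y : asym_max (x + y) <= asym_max x + asym_max y.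
Proof.
rewrite -lerBlDr; apply: asym_max_glb => r1 h1; rewrite lerBlDl -lerBlDr.
apply: asym_max_glb => r2 h2; rewrite lerBlDr addrC; apply: asym_max_le.
exact: asym_boundD.
Qed.

Lemma asym_maxZ s x : 0 < s -> asym_max (s%:C *: x) <= s * asym_max x.
Proof.
move=> s0; rewrite -ler_pdivrMl//; apply: asym_max_glb => r h; rewrite ler_pdivrMl//.
by apply: asym_max_le; exact: asym_boundZ.
Qed.

Lemma asym_bound_vanishing x e : cnorm (L k x) @[k --> \oo] --> (0 : R) ->
  0 < e -> asym_bound x e.
Proof.
move=> Lx e0; exists 0 => //; have /cvgrPdist_lt/(_ e e0) := Lx.
apply: filterS => k; rewrite sub0r normrN ger0_norm ?cnorm_ge0// => /ltW.
by rewrite rmorph0 scale0r !add0r.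
Qed.

(** The real functional f of the Hahn-Banach theorem is only used on self-adjoint
    elements; phi is the complex linear extension of its restriction to them. *)
Lemma asymptotic_state (a : A) : positive a -> exists phi : {scalar A},
  [/\ state phi,
      forall x, cnorm (L k x) @[k --> \oo] --> (0 : R) -> phi x = 0 &
      forall e, 0 < e -> \forall k \near \oo, cnorm (L k a) <= complex.Re (phi a) + e].
Proof.
move=> pa; have [f [fl fle fa]] := hahn_banach_complex a asym_maxD asym_maxZ.
have f0 : f 0 = 0.
  by have := fl 1 0 0; rewrite scaler0 addr0; lra.
have fN x : f (- x) = - f x.
  by have := fl (-1) x 0; rewrite rmorphN1 scaleN1r addr0 f0; lra.
have f_le x r : asym_bound x r -> f x <= r.
  by move=> h; apply: le_trans (fle x) _; exact: asym_max_le.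
pose re x := (2^-1 : R)%:C *: (x + star x).
pose g x := f (re x).
have gl t x y : g (t%:C *: x + y) = t * g x + g y.
  rewrite /g -fl; congr f; rewrite /re starD starR scalerA mulrC -scalerA -scalerDr.
  by rewrite addrACA -[in LHS]scalerDr.
have re_sa x : self_adjoint x -> re x = x.
  move=> sx; rewrite /re sx -{1 2}(scale1r x) -scalerDl scalerA.
  rewrite -(rmorph1 (real_complex R)) -rmorphD -rmorphM.
  by have -> : 2^-1 * (1 + 1) = 1 :> R; [lra|rewrite rmorph1 scale1r].
(* Hence phi is real on self-adjoint elements. *)
have re_isa x : self_adjoint x -> re ('i *: x) = 0.
  by move=> sx; rewrite /re starZ sx conj_i scaleNr subrr scaler0.
pose phi : {scalar A} := HB.pack (complexify g)
  (GRing.isLinear.Build R[i] A R[i] *%R (complexify g) (complexify_scalar gl)).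
have phi_sa x : self_adjoint x -> phi x = (f x)%:C.
  by move=> sx; rewrite /phi/= /complexify /g re_sa// re_isa// f0 oppr0.
have f_van x : cnorm (L k x) @[k --> \oo] --> (0 : R) -> f x <= 0.
  move=> Lx; apply/ler_addgt0Pl => e e0; rewrite addr0; apply: f_le.
  exact: asym_bound_vanishing.
have g_van x : cnorm (L k x) @[k --> \oo] --> (0 : R) -> g x = 0.
  move=> Lx.
  have Lre : cnorm (L k (re x)) @[k --> \oo] --> (0 : R).
    apply: (squeeze_cvgr _ (cvg_cst _) Lx); apply: nearW => k; rewrite cnorm_ge0/=.
    rewrite /re linearZ linearD /= L_star cnormR gtr0_norm ?invr_gt0//.
    rewrite ler_pdivrMl//; have := cnormD (L k x) (star (L k x)).
    by rewrite cnorm_starE; lra.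
  have LreN : cnorm (L k (- re x)) @[k --> \oo] --> (0 : R).
    by under eq_fun do rewrite linearN cnormN.
  by apply/le_anti; rewrite f_van//= -oppr_le0 -fN f_van.
exists phi; split.
- split=> [x px|].
    have [sx _] := px; rewrite phi_sa// ler0c -oppr_le0 -fN; apply: f_le.
    (* 0 bounds - x, because |t - L_k x| <= t for t = |x|. *)
    exists (cnorm x); first exact: cnorm_ge0.
    apply: nearW => k; rewrite linearN addr0; apply: positive_dist => //.
    exact: L_positive.
  rewrite phi_sa; last exact: self_adjoint1.
  have f1_le : f 1 <= 1 by apply: f_le; rewrite -(@cnorm1 R A); exact: asym_bound_cnorm.
  have f1_ge : f (- 1) <= - 1.
    apply: f_le; exists 1 => //; apply: nearW => k.
    by rewrite linearN L_1 rmorph1 scale1r !subrr cnorm_0.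
  have -> : f 1 = 1 by move: f1_ge; rewrite fN; lra.
  exact: rmorph1.
- move=> x Lx; rewrite /phi/= /complexify !g_van ?oppr0//.
  by under eq_fun do rewrite linearZ /= cnormI.
- move=> e e0; have [sa _] := pa; rewrite phi_sa//= fa.
  have [|r [t t0 h] re_lt] := @inf_adherent R [set r | asym_bound a r] e e0.
    split; first by exists (cnorm a); exact: asym_bound_cnorm.
    by exists (- cnorm a) => r; exact: asym_bound_ge.
  apply: filterS h => k; rewrite (cnorm_addr_positive t0 (L_positive k pa)) lerD2l => h.
  by apply: le_trans h _; exact: ltW.
Qed.

End AsymptoticState.

(** * Ergodic averages *)

Section Averages.
Context {R : realType} {A : cstarAlgType R}.
Implicit Types (x y : A) (l : R[i]).
Local Open Scope complex_scope.

(** Unital morphisms send invertible elements to invertible elements. *)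
Lemma spectrum_morphism (f : {lrmorphism A -> A}) x l :
  spectrum (f x) l -> spectrum x l.
Proof.
move=> h [y [xy yx]]; apply: h; exists (f y).
by rewrite -(rmorph_alg f l) -rmorphB -!rmorphM xy yx rmorph1.
Qed.

Lemma star_morphism_positive (f : {lrmorphism A -> A}) x :
  {morph f : z / star z} -> positive x -> positive (f x).
Proof.
move=> fs [sx px]; split; first by rewrite /self_adjoint -fs sx.
by move=> l /spectrum_morphism; exact: px.
Qed.

(** For self-adjoint y, the norm of f y is up to sign a spectral value of f y,
    hence of y; the general case is y = x^* x. *)
Lemma star_morphism_cnorm (f : {lrmorphism A -> A}) x :
  {morph f : z / star z} -> cnorm (f x) <= cnorm x.
Proof.
move=> fs; have sa_le y : self_adjoint y -> cnorm (f y) <= cnorm y.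
  move=> sy; have sfy : self_adjoint (f y) by rewrite /self_adjoint -fs sy.
  have [] := norm_spectrum sfy => /spectrum_morphism /spectrum_le_norm;
    rewrite normc_def /= expr0n addr0 sqrtr_sqr ?normrN ger0_norm ?cnorm_ge0//.
rewrite -(@ler_pXn2r _ 2) ?nnegrE ?cnorm_ge0// -!cnorm_star -fs -rmorphM.
by apply: sa_le; rewrite /self_adjoint starM starK.
Qed.

Context {G : groupType}.
Context (Theta : cstar_action G A).
Implicit Types (F : {fset G}) (g h : G).

Lemma act_star g : {morph Theta g : x / star x}.
Proof. by have [] := act_aut Theta g. Qed.

Lemma ergodic_averageE F x :
  ergodic_average Theta F x = (#|` F|%:R^-1 : R)%:C *: \sum_(g <- F) Theta g x.
Proof. by rewrite fmorphV rmorph_nat. Qed.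

Lemma ergodic_average_linear F : linear (ergodic_average Theta F).
Proof.
move=> c x y; rewrite /ergodic_average scalerA mulrC -scalerA -scalerDr.
congr (_ *: _); rewrite scaler_sumr -big_split /=.
by apply: eq_bigr => g _; rewrite linearP.
Qed.

HB.instance Definition _ F :=
  GRing.isLinear.Build R[i] A A *:%R (ergodic_average Theta F) (ergodic_average_linear F).

Lemma card_fset_gt0 F : F != fset0 -> 0 < (#|` F|%:R : R).
Proof. by rewrite ltr0n cardfs_gt0. Qed.

Lemma scaler_invn_mulrn (V : lmodType R[i]) (v : V) n :
  0 < (n%:R : R) -> (n%:R^-1 : R)%:C *: (v *+ n) = v.
Proof.
move=> n0; rewrite -[v *+ n]scaler_nat scalerA -(rmorph_nat (real_complex R)).
by rewrite -rmorphM mulVf ?gt_eqF// rmorph1 scale1r.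
Qed.

Lemma ergodic_average1 F : F != fset0 -> ergodic_average Theta F 1 = 1.
Proof.
move=> /card_fset_gt0 F0; rewrite ergodic_averageE (eq_bigr (fun=> 1)); last first.
  by move=> g _; rewrite rmorph1.
by rewrite big_const_seq count_predT iter_addr_0 scaler_invn_mulrn.
Qed.

Lemma ergodic_average_star F x :
  ergodic_average Theta F (star x) = star (ergodic_average Theta F x).
Proof.
rewrite !ergodic_averageE starR (big_morph _ (@starD R A) star0).
by congr (_ *: _); apply: eq_bigr => g _; rewrite act_star.
Qed.

Lemma ergodic_average_positive F x : positive x -> positive (ergodic_average Theta F x).
Proof.
move=> px; rewrite ergodic_averageE; apply: positiveR; first by rewrite invr_ge0.
apply: (big_ind (@positive R A)); [exact: positive0|exact: positiveD|].
by move=> g _; apply: star_morphism_positive px; exact: act_star.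
Qed.

Lemma cnorm_orbit_sum (s : seq G) x :
  cnorm (\sum_(g <- s) Theta g x) <= (size s)%:R * cnorm x.
Proof.
apply: le_trans (cnorm_sum _ _) _.
apply: (@le_trans _ _ (\sum_(g <- s) cnorm x)).
  by apply: ler_sum => g _; apply: star_morphism_cnorm; exact: act_star.
by rewrite big_const_seq count_predT iter_addr_0 mulr_natl.
Qed.

Lemma ergodic_average_cnorm F x : F != fset0 ->
  cnorm (ergodic_average Theta F x) <= cnorm x.
Proof.
move=> /card_fset_gt0 F0; rewrite ergodic_averageE cnormR gtr0_norm ?invr_gt0//.
by rewrite ler_pdivrMl//; exact: cnorm_orbit_sum.
Qed.

Lemma cnorm_orbit_sumB (X Y : {fset G}) x :
  cnorm (\sum_(g <- X) Theta g x - \sum_(g <- Y) Theta g x)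
    <= #|` fsymdiff X Y|%:R * cnorm x.
Proof.
have split_sum (U W : {fset G}) : \sum_(g <- U) Theta g x =
    \sum_(g <- (U `&` W)%fset) Theta g x + \sum_(g <- (U `\` W)%fset) Theta g x.
  rewrite (big_fsetID _ (mem W)); congr (_ + _); congr (\sum_(g <- enum_fset _) _).
    by apply/fsetP => g; rewrite !inE.
  by apply/fsetP => g; rewrite !inE andbC.
have -> : \sum_(g <- X) Theta g x - \sum_(g <- Y) Theta g x =
    \sum_(g <- (X `\` Y)%fset) Theta g x - \sum_(g <- (Y `\` X)%fset) Theta g x.
  rewrite (split_sum X Y) (split_sum Y X) fsetIC opprD addrACA subrr add0r.
  by [].
apply: le_trans (cnormB _ _) _.
apply: le_trans (lerD (cnorm_orbit_sum _ _) (cnorm_orbit_sum _ _)) _.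
rewrite -mulrDl -natrD ler_wpM2r ?cnorm_ge0// ler_nat /fsymdiff cardfsU.
suff -> : ((X `\` Y) `&` (Y `\` X))%fset = fset0 by rewrite cardfs0 subn0.
by apply/fsetP => g; rewrite !inE; case: (g \in X); rewrite ?andbF.
Qed.

(** As Theta_g Theta_h = Theta_(gh), the sum of the Theta_g (Theta_h x) over F is
    the sum of the Theta_g x over F h. *)
Lemma ergodic_average_translate F h x :
  cnorm (ergodic_average Theta F (Theta h x - x))
    <= (#|` fsymdiff (right_translate F h) F|%:R / #|` F|%:R) * cnorm x.
Proof.
rewrite ergodic_averageE cnormR ger0_norm ?invr_ge0// [_ / _]mulrC -mulrA.
rewrite ler_wpM2l ?invr_ge0//; apply: le_trans (cnorm_orbit_sumB _ _ _).
rewrite le_eqVlt; apply/orP; left; apply/eqP; congr cnorm.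
under eq_bigr do rewrite linearB.
rewrite big_split /= sumrN; congr (_ - _).
rewrite /right_translate big_imfset /=; last by move=> g1 g2 _ _; exact: mulIg.
by apply: eq_bigr => g _; rewrite actM.
Qed.

Lemma invariant_state_average (psi : {scalar A}) F x : F != fset0 ->
  invariant_states Theta psi -> psi (ergodic_average Theta F x) = psi x.
Proof.
move=> /card_fset_gt0 F0 [_ inv]; rewrite ergodic_averageE linearZ linear_sum /=.
rewrite (eq_bigr (fun=> psi x)) => [|g _]; last exact: inv.
rewrite big_const_seq count_predT iter_addr_0.
exact: (@scaler_invn_mulrn R[i]^o).
Qed.

End Averages.

(** * Convergence of the norms of the averages *)

Theorem theorem3p4 (R : realType) (A : cstarAlgType R) (G : groupType)
    (Theta : cstar_action G A) (F : nat -> {fset G}) (a : A) :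
  separable A ->
  countable [set: G] ->
  amenable R G ->
  right_Folner R F ->
  positive a ->
  cnorm (ergodic_average Theta (F k) a) @[k --> \oo]
    --> msup a (invariant_states Theta).
Proof.
move=> _ _ _ [F0 Folner] pa.
have [phi [sphi phi_van phi_a]] := @asymptotic_state R A
  (fun k => [the {linear A -> A} of ergodic_average Theta (F k)])
  (fun k => ergodic_average1 Theta (F0 k))
  (fun k x => ergodic_average_cnorm Theta x (F0 k))
  (fun k x => ergodic_average_star Theta (F k) x)
  (fun k x => @ergodic_average_positive R A G Theta (F k) x) a pa.
have iphi : invariant_states Theta phi.
  split=> // h x; apply/eqP; rewrite -subr_eq0 -linearB; apply/eqP/phi_van.
  apply: (squeeze_cvgr _ (cvg_cst _)).
    by apply: nearW => k; rewrite cnorm_ge0 /=; exact: ergodic_average_translate.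
  by rewrite -(mul0r (cnorm x)); apply: cvgMl; exact: Folner.
have le_avg k psi : invariant_states Theta psi ->
    complex.Re (psi a) <= cnorm (ergodic_average Theta (F k) a).
  move=> ipsi; rewrite -(invariant_state_average a (F0 k) ipsi).
  apply: state_le_cnorm; first by case: ipsi.
  by have [] := ergodic_average_positive Theta (F k) pa.
set S := [set complex.Re (psi a) | psi in invariant_states Theta].
have S0 : S !=set0 by exists (complex.Re (phi a)); exists phi.
have sup_le k : msup a (invariant_states Theta) <= cnorm (ergodic_average Theta (F k) a).
  by apply: ge_sup => // _ [psi ipsi <-]; exact: le_avg.
have le_sup : complex.Re (phi a) <= msup a (invariant_states Theta).
  apply: ub_le_sup; last by exists phi.
  by exists (cnorm (ergodic_average Theta (F 0) a)) => _ [psi ipsi <-]; exact: le_avg.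
(* With m the supremum, m <= |A_k a| <= phi a + e <= m + e
   for large k. *)
apply/cvgrPdist_le => e e0; apply: filterS (phi_a e e0) => k /= hk.
rewrite distrC ger0_norm ?subr_ge0// lerBlDl (le_trans hk)//.
by rewrite lerD2r.
Qed.
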